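(* Let $\mathbf{x}=(x_0,\dots,x_n)\in\mathbb{Z}^{n+1}$ with $x_n\neq 0$, and let $\mathfrak{w}=(q_0,\dots,q_n)$ be a tuple of positive integers (weights) with $q_0<q_1<\cdots<q_n$. For $i=0,1,\dots,n$ put $y_i=\gcd(x_i,\dots,x_n)$. Then $$\operatorname{wgcd}_{\mathfrak{w}}(x_0,\dots,x_n)=\operatorname{wgcd}_{\mathfrak{w}}(y_0,\dots,y_n),$$ and moreover $y_0\le y_1\le\cdots\le y_n$.
   Context: For a tuple of weights $\mathfrak{w}=(q_0,\dots,q_n)$ (positive integers) and a tuple of integers $\mathbf{x}=(x_0,\dots,x_n)$, not all zero, the weighted greatest common divisor $\operatorname{wgcd}_{\mathfrak{w}}(\mathbf{x})$ is the largest integer $d$ such that $d^{q_i}\mid x_i$ for all $i=0,\dots,n$ (such an integer exists). The ordinary $\gcd$ of a tuple of integers, not all zero, is the largest integer dividing all entries; in particular $\gcd(x_n)=|x_n|$. *)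

(* Defs.v *)
From mathcomp Require Import all_boot all_order all_algebra.
From mathcomp Require Import boolp classical_sets.

Set Implicit Arguments.
Unset Strict Implicit.
Unset Printing Implicit Defensive.

Import Order.TTheory GRing.Theory Num.Theory.
Local Open Scope ring_scope.

(* [largest P] is the maximum of P; it is 0 (a junk value) when P has none. *)
Definition is_largest (P : int -> Prop) (d : int) : Prop :=
  P d /\ forall e : int, P e -> e <= d.

Definition largest (P : int -> Prop) : int := xget 0 (is_largest P).

Definition wgcd (n : nat) (q : 'I_n -> nat) (x : 'I_n -> int) : int :=
  largest (fun d => forall i : 'I_n, (d ^+ q i %| x i)%Z).

(* gcd (x_i, ..., x_(n-1)) *)
Definition tail_gcd (n : nat) (x : 'I_n -> int) (i : 'I_n) : int :=
  \big[gcdz/0]_(j < n | (i <= j)%N) x j.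

Lemma wgcdP (n : nat) (q : 'I_n -> nat) (x : 'I_n -> int) :
    (forall i, (0 < q i)%N) -> (exists i, x i != 0) ->
  is_largest (fun d => forall i, (d ^+ q i %| x i)%Z) (wgcd q x).
Proof.
move=> q_gt0 [i0 xi0].
apply: (@xgetPex int 0 (is_largest (fun d => forall i, (d ^+ q i %| x i)%Z))).
pose p (m : nat) := [forall i, (m%:Z ^+ q i %| x i)%Z].
have bound (e : int) : (forall i, (e ^+ q i %| x i)%Z) -> (`|e| <= `|x i0|)%N.
  move=> /(_ i0); rewrite dvdzE abszX => dv.
  apply: leq_trans (dvdn_leq _ dv); last by rewrite absz_gt0.
  have := q_gt0 i0; case: (q i0) => // k _; rewrite expnS.
  by case: `|e|%N => // a; rewrite leq_pmulr // expn_gt0.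
have ex : exists m, p m by exists 1; apply/forallP => i; rewrite expr1n dvd1z.
have ub m : p m -> (m <= `|x i0|)%N by move=> /forallP /(bound m).
case: (ex_maxnP ex ub) => m /forallP pm maxm.
exists m%:Z; split => // e He.
apply: le_trans (lez_abs e) _; rewrite lez_nat; apply: maxm.
by apply/forallP => i; have := He i; rewrite !dvdzE !abszX absz_nat.
Qed.

Lemma tail_gcdP (n : nat) (x : 'I_n -> int) (i : 'I_n) :
    (exists2 j : 'I_n, (i <= j)%N & x j != 0) ->
  is_largest (fun d => forall j : 'I_n, (i <= j)%N -> (d %| x j)%Z)
             (tail_gcd x i).
Proof.
move=> [k ik xk].
have dvd_big (d : int) :
    (d %| tail_gcd x i)%Z = [forall j : 'I_n, (i <= j)%N ==> (d %| x j)%Z].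
  transitivity (\big[andb/true]_(j < n | (i <= j)%N) (d %| x j)%Z).
    rewrite /tail_gcd; apply: (big_morph (fun g => (d %| g)%Z)).
      by move=> a b; rewrite dvdz_gcd.
    by rewrite dvdz0.
  by rewrite big_andE.
have dv : forall j : 'I_n, (i <= j)%N -> (tail_gcd x i %| x j)%Z.
  have := dvdzz (tail_gcd x i); rewrite dvd_big => /forallP H j.
  exact/implyP.
split=> // e He.
have g0 : tail_gcd x i != 0.
  by apply: contra xk => /eqP g0; have := dv k ik; rewrite g0 dvd0z.
have ge0 : 0 <= tail_gcd x i.
  rewrite /tail_gcd unlock /=.
  elim: (index_enum _) (isT : true) => //= a s IH _; case: ifP => // _.
  exact: IH.
have : (e %| tail_gcd x i)%Z.
  by rewrite dvd_big; apply/forallP => j; apply/implyP => /He.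
rewrite dvdzE => /dvdn_leq; rewrite absz_gt0 => /(_ g0) le.
by apply: le_trans (lez_abs e) _; rewrite -[leRHS](gez0_abs ge0) lez_nat.
Qed.

(* Main.v *)
Require Import Defs.
From mathcomp Require Import all_boot all_order all_algebra.
From mathcomp Require Import boolp.

Local Open Scope ring_scope.

(** The two weighted gcds agree because the two families of divisibility
    conditions have exactly the same solutions [d].  Since [tail_gcd x i] divides
    [x i], a solution for the tail gcds is one for [x].  Conversely, the weights
    increase, so [d ^+ q i] divides [d ^+ q j], hence [x j], for every [j >= i],
    and therefore divides the gcd of this tail ([dvdz_tail_gcdP]).

    The tail gcds increase because a common divisor of a tail is a common divisor
    of every shorter tail; as the last entry is nonzero, each [tail_gcd x i] is
    the largest such divisor. *)

(** The universal property of the gcd; unlike its characterization as a maximum,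
    it also holds for a tail of zeros. *)
Lemma dvdz_tail_gcdP (n : nat) (x : 'I_n -> int) (i : 'I_n) (d : int) :
  reflect (forall j : 'I_n, (i <= j)%N -> (d %| x j)%Z) (d %| tail_gcd x i)%Z.
Proof.
have -> : (d %| tail_gcd x i)%Z =
    [forall j : 'I_n, (i <= j)%N ==> (d %| x j)%Z].
  rewrite -big_andE; apply: (big_morph (fun g => (d %| g)%Z)).
    by move=> a b; rewrite dvdz_gcd.
  by rewrite dvdz0.
by apply: (iffP forallP) => dv j; apply/implyP/dv.
Qed.

Lemma wgcd_tail_gcd (n : nat) (q : 'I_n -> nat) (x : 'I_n -> int) :
    (forall i j : 'I_n, (i <= j)%N -> (q i <= q j)%N) ->
  wgcd q (tail_gcd x) = wgcd q x.
Proof.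
move=> q_le; congr (largest _); apply/funext => d; apply/propext.
split=> dv i; first by move/dvdz_tail_gcdP: (dv i); apply.
apply/dvdz_tail_gcdP => j le_ij; apply: dvdz_trans (dv j).
exact/dvdz_exp2l/q_le.
Qed.

(** A nonzero last entry keeps every tail from being zero, which is what makes
    each tail gcd the maximum of its common divisors. *)
Lemma tail_gcd_le (n : nat) (x : 'I_n.+1 -> int) (i j : 'I_n.+1) :
  x ord_max != 0 -> (i <= j)%N -> tail_gcd x i <= tail_gcd x j.
Proof.
move=> x_neq0 le_ij.
have tail_neq0 : exists2 k : 'I_n.+1, (j <= k)%N & x k != 0.
  by exists ord_max; first exact: leq_ord.
have [_ max_j] := tail_gcdP tail_neq0; apply: max_j => k le_jk.
by move/dvdz_tail_gcdP: (dvdzz (tail_gcd x i)); apply; apply: leq_trans le_jk.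
Qed.

Theorem corollary3 (n : nat) (q : 'I_n.+1 -> nat) (x : 'I_n.+1 -> int)
    (hx : x ord_max != 0)
    (hq : forall i : 'I_n.+1, (0 < q i)%N)
    (hlt : forall i j : 'I_n.+1, (i < j)%N -> (q i < q j)%N) :
  wgcd q x = wgcd q (tail_gcd x) /\
  (forall i j : 'I_n.+1, (i <= j)%N -> tail_gcd x i <= tail_gcd x j).
Proof.
split=> [|i j]; last exact: tail_gcd_le.
apply/esym/wgcd_tail_gcd => i j; rewrite leq_eqVlt => /predU1P[/val_inj-> //|].
by move/hlt/ltnW.
Qed.
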